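(* Consider the action of $U(sl_2)\otimes U(sl_2)$ on the space $\mathbb{C}[x,y]$ realising the tensor product $V_{\lambda_1}\otimes V_{\lambda_2}$ of Verma modules of lowest weights $\lambda_1,\lambda_2$ (formulas in the context), and the change of coordinates \[(t,v)=\Bigl(x+y,\frac{y-x}{x+y}\Bigr).\] In the coordinates $(t,v)$ one has \[H\otimes1+1\otimes H\mapsto \lambda_1+\lambda_2+2t\partial_t,\] \[E\otimes1+1\otimes E\mapsto t,\] \[F\otimes1+1\otimes F\mapsto -t\partial_t^2-(\lambda_1+\lambda_2)\partial_t+t^{-1}\Phi^{\lambda_1,\lambda_2}_v,\] and \[\delta(C)\mapsto\frac{(\lambda_1+\lambda_2)(\lambda_1+\lambda_2-2)}{4}+\Phi^{\lambda_1,\lambda_2}_v.\]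
   Context: Standing assumptions: $N$ is a positive integer and $\lambda_1,\lambda_2\in\mathbb{C}$ satisfy $\lambda_1,\lambda_2\notin\{0,-1,\dots,-(N-1)\}$ and $\lambda_1+\lambda_2\notin\{0,-1,\dots,-(2N-2)\}$. $sl_2$ has generators $H,E,F$ with $[H,E]=2E$, $[H,F]=-2F$, $[E,F]=H$; the Casimir element is $C=\frac{H^2+2H}{4}+FE$; $\delta:U(sl_2)\to U(sl_2)^{\otimes2}$ is the algebra morphism with $\delta(x)=x\otimes1+1\otimes x$ for $x\in sl_2$. The Verma module $V_\lambda$ of lowest weight $\lambda$ is realised on polynomials in one variable $x$ by $H\mapsto\lambda+2x\partial_x$, $E\mapsto x$ (multiplication), $F\mapsto-x\partial_x^2-\lambda\partial_x$. On $V_{\lambda_1}\otimes V_{\lambda_2}=\mathbb{C}[x,y]$, the first tensor factor of $U(sl_2)^{\otimes2}$ acts by these formulas with $\lambda=\lambda_1$ in the variable $x$, and the second factor with $\lambda=\lambda_2$ in the variable $y$. The Jacobi operator is $\Phi^{\lambda,\lambda'}_v=(v^2-1)\partial_v^2+\bigl(\lambda-\lambda'+(\lambda+\lambda')v\bigr)\partial_v$. The inverse change of variables is $(x,y)=\bigl(\frac{t(1-v)}{2},\frac{t(1+v)}{2}\bigr)$, and in the new coordinates the representation space is the space of polynomials in $t$ and $tv$. *)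

(* Defs.v *)
From HB Require Import structures.
From mathcomp Require Import all_boot all_order all_algebra.
From mathcomp Require Import boolp reals complex.
From mathcomp Require Import mpoly.
From mathcomp Require Import ring.

Set Implicit Arguments.
Unset Strict Implicit.
Unset Printing Implicit Defensive.

Import GRing.Theory.
Local Open Scope ring_scope.
Local Open Scope quotient_scope.

Inductive term (K G : Type) : Type :=
| TGen of G
| TCst of K
| TAdd of term K G & term K G
| TMul of term K G & term K G.
Arguments TGen {K G}.
Arguments TCst {K G}.

Section PresentedAlgebra.
Variables (K : fieldType) (G : Type).
Implicit Types (a b : K) (s t u : term K G).

(* The least congruence containing [rel] that turns terms into an associative
   unital K-algebra; [TCst a] is the scalar [a] times the unit. *)
Inductive cong (rel : term K G -> term K G -> Prop) :
    term K G -> term K G -> Prop :=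
| cong_rel s t : rel s t -> cong rel s t
| cong_refl s : cong rel s s
| cong_sym s t : cong rel s t -> cong rel t s
| cong_trans s t u : cong rel s t -> cong rel t u -> cong rel s u
| cong_add s s' t t' :
    cong rel s s' -> cong rel t t' -> cong rel (TAdd s t) (TAdd s' t')
| cong_mul s s' t t' :
    cong rel s s' -> cong rel t t' -> cong rel (TMul s t) (TMul s' t')
| cong_addA s t u : cong rel (TAdd s (TAdd t u)) (TAdd (TAdd s t) u)
| cong_addC s t : cong rel (TAdd s t) (TAdd t s)
| cong_add0 s : cong rel (TAdd (TCst 0) s) s
| cong_addN s : cong rel (TAdd (TMul (TCst (-1)) s) s) (TCst 0)
| cong_mulA s t u : cong rel (TMul s (TMul t u)) (TMul (TMul s t) u)
| cong_mul1l s : cong rel (TMul (TCst 1) s) s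
| cong_mul1r s : cong rel (TMul s (TCst 1)) s
| cong_mulDl s t u :
    cong rel (TMul (TAdd s t) u) (TAdd (TMul s u) (TMul t u))
| cong_mulDr s t u :
    cong rel (TMul s (TAdd t u)) (TAdd (TMul s t) (TMul s u))
| cong_cstD a b : cong rel (TAdd (TCst a) (TCst b)) (TCst (a + b))
| cong_cstM a b : cong rel (TMul (TCst a) (TCst b)) (TCst (a * b))
| cong_cstC a s : cong rel (TMul (TCst a) s) (TMul s (TCst a)).

Fixpoint teval (A : algType K) (f : G -> A) (t : term K G) : A :=
  match t with
  | TGen g => f g
  | TCst a => a%:A
  | TAdd s t => teval f s + teval f t
  | TMul s t => teval f s * teval f t
  end.

Variable rel : term K G -> term K G -> Prop.

Definition respects (A : algType K) (f : G -> A) :=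
  forall s t, rel s t -> teval f s = teval f t.

Lemma teval_cong (A : algType K) (f : G -> A) :
  respects f -> forall s t, cong rel s t -> teval f s = teval f t.
Proof.
move=> fP s t; elim=> {s t} //=.
- by move=> s t u _ -> _ ->.
- by move=> s s' t t' _ -> _ ->.
- by move=> s s' t t' _ -> _ ->.
- by move=> s t u; rewrite addrA.
- by move=> s t; rewrite addrC.
- by move=> s; rewrite scale0r add0r.
- by move=> s; rewrite scaleN1r mulN1r addNr scale0r.
- by move=> s t u; rewrite mulrA.
- by move=> s; rewrite scale1r mul1r.
- by move=> s; rewrite scale1r mulr1.
- by move=> s t u; rewrite mulrDl.
- by move=> s t u; rewrite mulrDr.
- by move=> a b; rewrite scalerDl.
- by move=> a b; rewrite -scalerAl mul1r scalerA.
- by move=> a s; rewrite -scalerAl mul1r -scalerAr mulr1.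
Qed.

Definition congb (s t : {classic term K G}) : bool := `[< cong rel s t >].

Lemma congb_refl : reflexive congb.
Proof. by move=> s; apply/asboolP/cong_refl. Qed.

Lemma congb_sym : ssrbool.symmetric congb.
Proof. by move=> s t; apply/asboolP/asboolP; apply: cong_sym. Qed.

Lemma congb_trans : transitive congb.
Proof.
by move=> t s u /asboolP st /asboolP tu; apply/asboolP/(cong_trans st tu).
Qed.

Canonical cong_equiv := EquivRel congb congb_refl congb_sym congb_trans.

(* MathComp algebras are nontrivial, hence the argument [nt]. *)
Variable nt : ~ cong rel (TCst 1) (TCst 0).

Definition palg of ~ cong rel (TCst 1) (TCst 0) : Type := {eq_quot cong_equiv}.
Local Notation P := (palg nt).

HB.instance Definition _ := Choice.copy P {eq_quot cong_equiv}.
HB.instance Definition _ : EqQuotient _ cong_equiv P :=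
  EqQuotient.copy P {eq_quot cong_equiv}.

Definition pclass (t : term K G) : P := \pi_P (t : {classic term K G}).
Definition prepr (x : P) : term K G := repr x.

Lemma preprK x : pclass (prepr x) = x. Proof. exact: reprK. Qed.

Lemma pclassE s t : pclass s = pclass t <-> cong rel s t.
Proof.
split=> [/eqmodP/asboolP //|st].
by apply/eqmodP/asboolP.
Qed.

Lemma pclassK t : cong rel (prepr (pclass t)) t.
Proof. by apply/pclassE; rewrite preprK. Qed.

Definition padd (x y : P) : P := pclass (TAdd (prepr x) (prepr y)).
Definition pmul (x y : P) : P := pclass (TMul (prepr x) (prepr y)).
Definition pcst a : P := pclass (TCst a).
Definition popp (x : P) : P := pmul (pcst (-1)) x.

Lemma paddE s t : padd (pclass s) (pclass t) = pclass (TAdd s t).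
Proof. by apply/pclassE/cong_add; apply: pclassK. Qed.

Lemma pmulE s t : pmul (pclass s) (pclass t) = pclass (TMul s t).
Proof. by apply/pclassE/cong_mul; apply: pclassK. Qed.

Let pE := (paddE, pmulE).

Fact paddA : associative padd.
Proof.
move=> x y z; rewrite -[x]preprK -[y]preprK -[z]preprK !pE.
exact/pclassE/cong_addA.
Qed.
Fact paddC : commutative padd.
Proof. by move=> x y; apply/pclassE/cong_addC. Qed.
Fact padd0 : left_id (pcst 0) padd.
Proof. by move=> x; rewrite -[x]preprK pE; apply/pclassE/cong_add0. Qed.
Fact paddN : left_inverse (pcst 0) popp padd.
Proof.
by move=> x; rewrite -[x]preprK /popp pmulE paddE; apply/pclassE/cong_addN.
Qed.
HB.instance Definition _ := GRing.isZmodule.Build P paddA paddC padd0 paddN.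

Fact pmulA : associative pmul.
Proof.
move=> x y z; rewrite -[x]preprK -[y]preprK -[z]preprK !pE.
exact/pclassE/cong_mulA.
Qed.
Fact pmul1l : left_id (pcst 1) pmul.
Proof. by move=> x; rewrite -[x]preprK pE; apply/pclassE/cong_mul1l. Qed.
Fact pmul1r : right_id (pcst 1) pmul.
Proof. by move=> x; rewrite -[x]preprK pE; apply/pclassE/cong_mul1r. Qed.
Fact pmulDl : left_distributive pmul padd.
Proof.
move=> x y z; rewrite -[x]preprK -[y]preprK -[z]preprK !pE.
exact/pclassE/cong_mulDl.
Qed.
Fact pmulDr : right_distributive pmul padd.
Proof.
move=> x y z; rewrite -[x]preprK -[y]preprK -[z]preprK !pE.
exact/pclassE/cong_mulDr.
Qed.
Fact pone_neq0 : pcst 1 != 0.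
Proof. by apply/eqP => /pclassE. Qed.
HB.instance Definition _ := GRing.Zmodule_isNzRing.Build P
  pmulA pmul1l pmul1r pmulDl pmulDr pone_neq0.

Definition pscale a (x : P) : P := pcst a * x.

Fact pscaleA a b x : pscale a (pscale b x) = pscale (a * b) x.
Proof.
by rewrite /pscale mulrA; congr (_ * _); rewrite -[LHS]/(pmul _ _) pE;
   apply/pclassE/cong_cstM.
Qed.
Fact pscale1 : left_id 1 pscale. Proof. exact: pmul1l. Qed.
Fact pscaleDr : right_distributive pscale +%R.
Proof. by move=> a x y; apply: mulrDr. Qed.
Fact pscaleDl x : {morph pscale^~ x : a b / a + b}.
Proof.
move=> a b; rewrite /pscale -mulrDl; congr (_ * _); apply/esym.
by rewrite -[LHS]/(padd _ _) pE; apply/pclassE/cong_cstD.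
Qed.
HB.instance Definition _ :=
  GRing.Zmodule_isLmodule.Build K P pscaleA pscale1 pscaleDr pscaleDl.

Fact pscaleAl a (x y : P) : a *: (x * y) = (a *: x) * y.
Proof. exact: mulrA. Qed.
HB.instance Definition _ := GRing.Lmodule_isLalgebra.Build K P pscaleAl.

Fact pscaleAr a (x y : P) : a *: (x * y) = x * (a *: y).
Proof.
rewrite -[LHS]/(pcst a * (x * y)) -[a *: y]/(pcst a * y) !mulrA.
congr (_ * _); rewrite -[x]preprK -[LHS]/(pmul _ _) -[RHS]/(pmul _ _) !pE.
exact/pclassE/cong_cstC.
Qed.
HB.instance Definition _ := GRing.Lalgebra_isAlgebra.Build K P pscaleAr.

Definition pgen (g : G) : P := pclass (TGen g).

Lemma pclass_teval t : pclass t = teval pgen t.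
Proof.
elim: t => //= [a|s <- t <-|s <- t <-].
- by rewrite -[RHS]/(pcst a * 1) mulr1.
- by rewrite -[RHS]/(padd _ _) pE.
- by rewrite -[RHS]/(pmul _ _) pE.
Qed.

Lemma palg_rel s t : rel s t -> teval pgen s = teval pgen t.
Proof. by move=> st; rewrite -!pclass_teval; apply/pclassE/cong_rel. Qed.

Section Lift.
Variables (A : algType K) (f : G -> A).

Definition plift of respects f : P -> A := fun x => teval f (prepr x).

Variable fP : respects f.
Local Notation "f^" := (plift fP).

Lemma plift_class t : f^ (pclass t) = teval f t.
Proof. exact/(teval_cong fP)/pclassK. Qed.

Lemma plift_gen g : f^ (pgen g) = f g. Proof. exact: plift_class. Qed.

Fact plift_is_linear : linear f^.
Proof.
move=> a x y; rewrite -[x]preprK -[y]preprK -[_ *: _]/(pmul _ _) pE.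
by rewrite -[_ + _]/(padd _ _) pE !plift_class /= -scalerAl mul1r.
Qed.
Fact plift_is_monoid : monoid_morphism f^.
Proof.
split=> [|x y]; first by rewrite plift_class /= scale1r.
by rewrite -[x]preprK -[y]preprK -[_ * _]/(pmul _ _) pE !plift_class.
Qed.
HB.instance Definition _ := GRing.isLinear.Build K P A _ f^ plift_is_linear.
HB.instance Definition _ :=
  GRing.isMonoidMorphism.Build P A f^ plift_is_monoid.

Lemma plift_comm (d : A) :
  (forall g, GRing.comm d (f g)) -> forall x, GRing.comm d (f^ x).
Proof.
move=> df x; rewrite -[x]preprK plift_class /GRing.comm.
elim: (prepr x) => //= [a|s IHs t IHt|s IHs t IHt].
- by rewrite -scalerAr -scalerAl mulr1 mul1r.
- by rewrite mulrDl mulrDr IHs IHt.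
- by rewrite mulrA IHs -!mulrA IHt.
Qed.

End Lift.
End PresentedAlgebra.
Arguments plift {K G rel} nt {A f}.

Section Tensor.
Variables (K : fieldType) (A B : algType K).

(* The generator [(a, b)] stands for the pure tensor a (x) b. *)
Local Notation "a '#' b" := (TGen (a, b)) (at level 35).

Inductive tensor_rel : term K (A * B) -> term K (A * B) -> Prop :=
| tensor_Dl a a' b : tensor_rel ((a + a') # b) (TAdd (a # b) (a' # b))
| tensor_Dr a b b' : tensor_rel (a # (b + b')) (TAdd (a # b) (a # b'))
| tensor_Zl k a b : tensor_rel ((k *: a) # b) (TMul (TCst k) (a # b))
| tensor_Zr k a b : tensor_rel (a # (k *: b)) (TMul (TCst k) (a # b))
| tensor_1 : tensor_rel (1 # 1) (TCst 1)
| tensor_M a a' b b' :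
    tensor_rel (TMul (a # b) (a' # b')) ((a * a') # (b * b')).

Variables (D : algType K) (f : {lrmorphism A -> D}) (g : {lrmorphism B -> D}).

Definition tensor_fun (ab : A * B) : D := f ab.1 * g ab.2.

Lemma tensor_respects :
  (forall a b, GRing.comm (f a) (g b)) -> respects tensor_rel tensor_fun.
Proof.
move=> fg s t; case=> {s t} /=; rewrite /tensor_fun /=.
- by move=> a a' b; rewrite rmorphD mulrDl.
- by move=> a b b'; rewrite rmorphD mulrDr.
- by move=> k a b; rewrite linearZ /= -!scalerAl mul1r.
- by move=> k a b; rewrite linearZ /= -scalerAr -scalerAl mul1r.
- by rewrite !rmorph1 mulr1 scale1r.
- move=> a a' b b'; rewrite !rmorphM !mulrA; congr (_ * _).
  by rewrite -!mulrA; congr (_ * _); rewrite fg.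
Qed.

End Tensor.

Inductive sl2_gen := gH | gE | gF.

Section Usl2.
Variable K : fieldType.

Definition tbracket (s t : term K sl2_gen) : term K sl2_gen :=
  TAdd (TMul s t) (TMul (TCst (-1)) (TMul t s)).

Inductive sl2_rel : term K sl2_gen -> term K sl2_gen -> Prop :=
| sl2_HE : sl2_rel (tbracket (TGen gH) (TGen gE)) (TMul (TCst 2) (TGen gE))
| sl2_HF : sl2_rel (tbracket (TGen gH) (TGen gF)) (TMul (TCst (-2)) (TGen gF))
| sl2_EF : sl2_rel (tbracket (TGen gE) (TGen gF)) (TGen gH).

Definition bracket (A : algType K) (x y : A) : A := x * y - y * x.

Lemma sl2_respects (A : algType K) (h e f : A) :
  bracket h e = 2 *: e -> bracket h f = - 2 *: f -> bracket e f = h ->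
  respects sl2_rel (fun g => match g with gH => h | gE => e | gF => f end).
Proof.
by move=> he hf ef s t [] /=; rewrite -?scalerAl ?mul1r scaleN1r.
Qed.

Lemma counit_respects : respects sl2_rel (fun=> 0 : K^o).
Proof. by move=> s t [] /=; rewrite !(mulr0, mul0r, addr0). Qed.

Lemma usl2_nontrivial : ~ cong sl2_rel (TCst 1) (TCst 0).
Proof.
move/(teval_cong counit_respects)/eqP => /=.
by rewrite scale1r scale0r oner_eq0.
Qed.

Definition usl2 := palg usl2_nontrivial.
HB.instance Definition _ := GRing.Algebra.on usl2.

Definition sl2H : usl2 := pgen usl2_nontrivial gH.
Definition sl2E : usl2 := pgen usl2_nontrivial gE.
Definition sl2F : usl2 := pgen usl2_nontrivial gF.

Lemma bracket_HE : bracket sl2H sl2E = 2 *: sl2E.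
Proof.
have := palg_rel usl2_nontrivial sl2_HE.
by rewrite /= -!scalerAl !mul1r scaleN1r.
Qed.
Lemma bracket_HF : bracket sl2H sl2F = - 2 *: sl2F.
Proof.
have := palg_rel usl2_nontrivial sl2_HF.
by rewrite /= -!scalerAl !mul1r scaleN1r.
Qed.
Lemma bracket_EF : bracket sl2E sl2F = sl2H.
Proof.
have := palg_rel usl2_nontrivial sl2_EF.
by rewrite /= -!scalerAl !mul1r scaleN1r.
Qed.

Definition casimir : usl2 := 4^-1 *: (sl2H ^+ 2 + 2 *: sl2H) + sl2F * sl2E.

Section Lift.
Variables (A : algType K) (h e f : A).
Hypotheses (he : bracket h e = 2 *: e) (hf : bracket h f = - 2 *: f).
Hypothesis (ef : bracket e f = h).

Definition usl2_lift : {lrmorphism usl2 -> A} :=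
  plift usl2_nontrivial (sl2_respects he hf ef).

Lemma usl2_liftH : usl2_lift sl2H = h. Proof. exact: plift_gen. Qed.
Lemma usl2_liftE : usl2_lift sl2E = e. Proof. exact: plift_gen. Qed.
Lemma usl2_liftF : usl2_lift sl2F = f. Proof. exact: plift_gen. Qed.

Lemma usl2_lift_comm (d : A) :
  GRing.comm d h -> GRing.comm d e -> GRing.comm d f ->
  forall x, GRing.comm d (usl2_lift x).
Proof. by move=> dh de df x; apply: plift_comm; case. Qed.

End Lift.

Definition counit : {lrmorphism usl2 -> K^o} :=
  plift usl2_nontrivial counit_respects.

Lemma usl2_tensor_nontrivial :
  ~ cong (@tensor_rel K usl2 usl2) (TCst 1) (TCst 0).
Proof.
have cc (a b : usl2) : GRing.comm (counit a) (counit b) by apply: mulrC.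
move/(teval_cong (tensor_respects cc))/eqP => /=.
by rewrite scale1r scale0r oner_eq0.
Qed.

Definition usl2_2 := palg usl2_tensor_nontrivial.
HB.instance Definition _ := GRing.Algebra.on usl2_2.

Definition tens (a b : usl2) : usl2_2 := pgen usl2_tensor_nontrivial (a, b).
Local Notation "a ⊗ b" := (tens a b) (at level 35).

Lemma tensDl a a' b : (a + a') ⊗ b = a ⊗ b + a' ⊗ b.
Proof. exact: (palg_rel usl2_tensor_nontrivial (tensor_Dl _ _ _)). Qed.
Lemma tensDr a b b' : a ⊗ (b + b') = a ⊗ b + a ⊗ b'.
Proof. exact: (palg_rel usl2_tensor_nontrivial (tensor_Dr _ _ _)). Qed.
Lemma tensZl k a b : (k *: a) ⊗ b = k *: (a ⊗ b).
Proof.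
have := palg_rel usl2_tensor_nontrivial (tensor_Zl k a b).
by rewrite /= -scalerAl mul1r.
Qed.
Lemma tensZr k a b : a ⊗ (k *: b) = k *: (a ⊗ b).
Proof.
have := palg_rel usl2_tensor_nontrivial (tensor_Zr k a b).
by rewrite /= -scalerAl mul1r.
Qed.
Lemma tens11 : 1 ⊗ 1 = 1.
Proof.
by have := palg_rel usl2_tensor_nontrivial (tensor_1 _ _); rewrite /= scale1r.
Qed.
Lemma tensM a a' b b' : (a ⊗ b) * (a' ⊗ b') = (a * a') ⊗ (b * b').
Proof. exact: (palg_rel usl2_tensor_nontrivial (tensor_M _ _ _ _)). Qed.

Definition primitive (x : usl2) : usl2_2 := x ⊗ 1 + 1 ⊗ x.

Lemma primitive_bracket x y :
  bracket (primitive x) (primitive y) = primitive (bracket x y).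
Proof.
have tensNl a b : (- a) ⊗ b = - (a ⊗ b) by rewrite -!scaleN1r tensZl.
have tensNr a b : a ⊗ (- b) = - (a ⊗ b) by rewrite -!scaleN1r tensZr.
have ac (V : zmodType) (p q r s p' s' : V) :
    p + q + (r + s) - (p' + r + (q + s')) = p - p' + (s - s').
  rewrite [p' + r + _]addrACA opprD addrACA; congr (_ + _).
    by rewrite opprD addrACA subrr addr0.
  by rewrite opprD addrACA subrr add0r.
rewrite /bracket /primitive !mulrDl !mulrDr !tensM !mulr1 !mul1r ac.
by rewrite tensDl tensDr tensNl tensNr.
Qed.

Lemma primitiveZ k x : primitive (k *: x) = k *: primitive x.
Proof. by rewrite /primitive tensZl tensZr scalerDr. Qed.

Fact delta_HE : bracket (primitive sl2H) (primitive sl2E) = 2 *: primitive sl2E.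
Proof. by rewrite primitive_bracket bracket_HE primitiveZ. Qed.
Fact delta_HF : bracket (primitive sl2H) (primitive sl2F) = - 2 *: primitive sl2F.
Proof. by rewrite primitive_bracket bracket_HF primitiveZ. Qed.
Fact delta_EF : bracket (primitive sl2E) (primitive sl2F) = primitive sl2H.
Proof. by rewrite primitive_bracket bracket_EF. Qed.

Definition delta : {lrmorphism usl2 -> usl2_2} :=
  usl2_lift delta_HE delta_HF delta_EF.

Lemma delta_primitive :
  [/\ delta sl2H = sl2H ⊗ 1 + 1 ⊗ sl2H, delta sl2E = sl2E ⊗ 1 + 1 ⊗ sl2E
    & delta sl2F = sl2F ⊗ 1 + 1 ⊗ sl2F].
Proof. by split; [apply: usl2_liftH|apply: usl2_liftE|apply: usl2_liftF]. Qed.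

Section TensorLift.
Variables (D : algType K) (f g : {lrmorphism usl2 -> D}).
Hypothesis fg : forall a b, GRing.comm (f a) (g b).

Definition tens_lift : {lrmorphism usl2_2 -> D} :=
  plift usl2_tensor_nontrivial (tensor_respects fg).

Lemma tens_liftE a b : tens_lift (a ⊗ b) = f a * g b.
Proof. exact: plift_gen. Qed.
End TensorLift.

End Usl2.

Arguments sl2H {K}.
Arguments sl2E {K}.
Arguments sl2F {K}.
Arguments casimir {K}.
Arguments delta {K}.

Notation "a ⊗ b" := (tens a b) (at level 35).

Section Endo.
Variables (K : fieldType) (V : lalgType K).

Record endo := Endo { endo_fun :> V -> V; endoP : `[< linear endo_fun >] }.

HB.instance Definition _ := [isSub for endo_fun].
HB.instance Definition _ := gen_eqMixin endo.
HB.instance Definition _ := gen_choiceMixin endo.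

Implicit Types f g h : endo.

Definition mk_endo (f : {linear V -> V}) : endo :=
  Endo (asboolT (linearP f)).

Lemma endo_linear f : linear f. Proof. exact/asboolP/endoP. Qed.
HB.instance Definition _ f := GRing.isLinear.Build K V V _ f (endo_linear f).

Lemma endo_eq f g : f =1 g -> f = g.
Proof. by move=> fg; apply: val_inj; apply/funext. Qed.

Definition endo0 := mk_endo \0.
Definition endoN f := mk_endo (\- f).
Definition endoD f g := mk_endo (f \+ g).
Definition endo1 := mk_endo idfun.
Definition endoM f g := mk_endo (f \o g).
Definition endoZ (a : K) f := mk_endo (a \*: f).

Fact endoDA : associative endoD.
Proof. by move=> f g h; apply: endo_eq => v /=; rewrite addrA. Qed.
Fact endoDC : commutative endoD.
Proof. by move=> f g; apply: endo_eq => v /=; rewrite addrC. Qed.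
Fact endoD0 : left_id endo0 endoD.
Proof. by move=> f; apply: endo_eq => v /=; rewrite add0r. Qed.
Fact endoDN : left_inverse endo0 endoN endoD.
Proof. by move=> f; apply: endo_eq => v /=; rewrite addNr. Qed.
HB.instance Definition _ := GRing.isZmodule.Build endo endoDA endoDC endoD0 endoDN.

Fact endoMA : associative endoM. Proof. by move=> f g h; apply: endo_eq. Qed.
Fact endoM1l : left_id endo1 endoM. Proof. by move=> f; apply: endo_eq. Qed.
Fact endoM1r : right_id endo1 endoM. Proof. by move=> f; apply: endo_eq. Qed.
Fact endoMDl : left_distributive endoM endoD.
Proof. by move=> f g h; apply: endo_eq. Qed.
Fact endoMDr : right_distributive endoM endoD.
Proof. by move=> f g h; apply: endo_eq => v /=; rewrite linearD. Qed.
Fact endo1_neq0 : endo1 != 0.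
Proof.
apply/eqP => /(congr1 (fun f : endo => f 1)) /= /eqP.
by rewrite oner_eq0.
Qed.
HB.instance Definition _ := GRing.Zmodule_isNzRing.Build endo
  endoMA endoM1l endoM1r endoMDl endoMDr endo1_neq0.

Fact endoZA a b f : endoZ a (endoZ b f) = endoZ (a * b) f.
Proof. by apply: endo_eq => v /=; rewrite scalerA. Qed.
Fact endoZ1 : left_id 1 endoZ.
Proof. by move=> f; apply: endo_eq => v /=; rewrite scale1r. Qed.
Fact endoZDr : right_distributive endoZ +%R.
Proof. by move=> a f g; apply: endo_eq => v /=; rewrite scalerDr. Qed.
Fact endoZDl f : {morph endoZ^~ f : a b / a + b}.
Proof. by move=> a b; apply: endo_eq => v /=; rewrite scalerDl. Qed.
HB.instance Definition _ :=
  GRing.Zmodule_isLmodule.Build K endo endoZA endoZ1 endoZDr endoZDl.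

Fact endoZAl (a : K) f g : a *: (f * g) = (a *: f) * g.
Proof. exact: endo_eq. Qed.
HB.instance Definition _ := GRing.Lmodule_isLalgebra.Build K endo endoZAl.
Fact endoZAr (a : K) f g : a *: (f * g) = f * (a *: g).
Proof. by apply: endo_eq => v /=; rewrite linearZ. Qed.
HB.instance Definition _ := GRing.Lalgebra_isAlgebra.Build K endo endoZAr.

Lemma endoDE f g v : (f + g) v = f v + g v. Proof. by []. Qed.
Lemma endoNE f v : (- f) v = - f v. Proof. by []. Qed.
Lemma endoME f g v : (f * g) v = f (g v). Proof. by []. Qed.
Lemma endoZE (a : K) f v : (a *: f) v = a *: f v. Proof. by []. Qed.

End Endo.

Section Verma.
Variables (K : fieldType) (n : nat) (i : 'I_n) (lam : K).
Local Notation V := {mpoly K[n]}.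
Implicit Type p : V.
Local Notation x := ('X_i : V).

Definition vermaH p : V := lam *: p + 2 *: (x * p^`M(i)).
Definition vermaE p : V := x * p.
Definition vermaF p : V := - (x * p^`M(i)^`M(i)) - lam *: p^`M(i).

Fact vermaH_linear : linear vermaH.
Proof.
move=> a p q; rewrite /vermaH mderivD mderivZ -!mul_mpolyC mpolyC_nat.
ring.
Qed.
Fact vermaE_linear : linear vermaE.
Proof. by move=> a p q; rewrite /vermaE mulrDr -scalerAr. Qed.
Fact vermaF_linear : linear vermaF.
Proof.
move=> a p q; rewrite /vermaF !(mderivD, mderivZ) -!mul_mpolyC.
ring.
Qed.
HB.instance Definition _ := GRing.isLinear.Build K V V _ vermaH vermaH_linear.
HB.instance Definition _ := GRing.isLinear.Build K V V _ vermaE vermaE_linear.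
HB.instance Definition _ := GRing.isLinear.Build K V V _ vermaF vermaF_linear.

Lemma mderivXM p : (x * p)^`M(i) = p + x * p^`M(i).
Proof.
rewrite mderivM mderivX mnm1E eqxx scale1r.
have -> : (U_(i) - U_(i) = 0 :> 'X_{1..n})%MM.
  by apply/mnmP => j; rewrite mnmBE subnn mnm0E.
by rewrite mpolyX0 mul1r.
Qed.


Fact verma_HE :
  bracket (mk_endo vermaH) (mk_endo vermaE) = 2 *: mk_endo vermaE.
Proof.
apply: endo_eq => p; rewrite endoDE endoNE endoZE !endoME /=.
rewrite /vermaH /vermaE mderivXM -!mul_mpolyC mpolyC_nat; ring.
Qed.
Fact verma_HF :
  bracket (mk_endo vermaH) (mk_endo vermaF) = - 2 *: mk_endo vermaF.
Proof.
apply: endo_eq => p; rewrite endoDE endoNE endoZE !endoME /=.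
rewrite /vermaH /vermaF !(mderivXM, mderivD, mderivB, mderivN, mderivZ).
rewrite -!mul_mpolyC mpolyCN mpolyC_nat; ring.
Qed.
Fact verma_EF :
  bracket (mk_endo vermaE) (mk_endo vermaF) = mk_endo vermaH.
Proof.
apply: endo_eq => p; rewrite endoDE endoNE !endoME /=.
rewrite /vermaH /vermaE /vermaF !(mderivXM, mderivD) -!mul_mpolyC mpolyC_nat.
ring.
Qed.

(* The Verma module of lowest weight [lam], on the polynomials in 'X_i. *)
Definition verma : {lrmorphism usl2 K -> endo V} :=
  usl2_lift verma_HE verma_HF verma_EF.

Lemma vermaE_gen p :
  [/\ verma sl2H p = vermaH p, verma sl2E p = vermaE p
    & verma sl2F p = vermaF p].
Proof. by rewrite /verma usl2_liftH usl2_liftE usl2_liftF. Qed.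

Lemma verma_comm (d : endo V) :
  (forall p, d (x * p) = x * d p) -> (forall p, d p^`M(i) = (d p)^`M(i)) ->
  forall u, GRing.comm d (verma u).
Proof.
move=> dX dD; apply: usl2_lift_comm; apply: endo_eq => p; rewrite !endoME /=.
- by rewrite /vermaH linearD /= !linearZ /= dX dD.
- exact: dX.
- by rewrite /vermaF linearB /= linearN linearZ /= dX !dD.
Qed.

End Verma.

Section TensorRep.
Variables (K : fieldType) (l1 l2 : K).

Local Notation i0 := (ord0 : 'I_2).
Local Notation i1 := (ord_max : 'I_2).

Fact verma12_comm (a b : usl2 K) :
  GRing.comm (verma i0 l1 a) (verma i1 l2 b).
Proof.
have X01 (i j : 'I_2) (p : {mpoly K[2]}) :
    i != j -> ('X_j * p)^`M(i) = 'X_j * p^`M(i).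
  move=> ij; rewrite mderivM mderivX mnm1E eq_sym (negPf ij).
  by rewrite scale0r mul0r add0r.
apply: verma_comm => p.
- have := @verma_comm K 2 i0 l1 (mk_endo (vermaE i1)) _ _ a.
  move=> /(_ _ _)/(congr1 (fun f : endo _ => f p)); rewrite !endoME => <- // q.
    by rewrite /= /vermaE mulrCA.
  by rewrite /= /vermaE X01.
- have := @verma_comm K 2 i0 l1 (mk_endo (mderiv i1)) _ _ a.
  move=> /(_ _ _)/(congr1 (fun f : endo _ => f p)); rewrite !endoME => <- // q.
    by rewrite /= X01.
  by rewrite /= mderiv_comm.
Qed.

(* The action on V_l1 (x) V_l2 = K[x, y], where x = 'X_0 and y = 'X_1. *)
Definition tensor_rep : {lrmorphism usl2_2 K -> endo {mpoly K[2]}} :=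
  tens_lift verma12_comm.

Lemma tensor_repE a b p :
  tensor_rep (a ⊗ b) p = verma i0 l1 a (verma i1 l2 b p).
Proof. by rewrite tens_liftE. Qed.
End TensorRep.

Fact inv_change_x (F : fieldType) (x y : F) : (2 : F) != 0 -> x + y != 0 ->
  (x + y) * (1 - (y - x) / (x + y)) / 2 = x.
Proof. by move=> two xy; field; rewrite two. Qed.

Fact inv_change_y (F : fieldType) (x y : F) : (2 : F) != 0 -> x + y != 0 ->
  (x + y) * (1 + (y - x) / (x + y)) / 2 = y.
Proof. by move=> two xy; field; rewrite two. Qed.

Section Coordinates.
Variable K : fieldType.
Local Notation Pol := {mpoly K[2]}.
Local Notation Rat := {fraction {mpoly K[2]}}.
Local Notation "p %:F" := (@FracField.tofrac {mpoly K[2]} p).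
Local Notation i0 := (ord0 : 'I_2).
Local Notation i1 := (ord_max : 'I_2).
Implicit Types (p q : Pol) (f g : Rat).

Definition num f : Pol := \n_(repr f).
Definition den f : Pol := \d_(repr f).

Lemma den_neq0 f : den f != 0. Proof. exact: denom_ratioP. Qed.

Lemma num_den f : f = (num f)%:F / (den f)%:F.
Proof.
rewrite -{1}[f]reprK /num /den; case: (repr f) => -[n d] /= d0.
rewrite -[_ / _]/(FracField.mul _ (FracField.inv _)) !piE.
apply: (congr1 \pi_(FracField.type Pol)); apply: val_inj.
rewrite /FracField.mulf /FracField.invf.
rewrite !numden_Ratio ?oner_neq0 // mulr1 mul1r.
by rewrite /Ratio /insubd insubT.
Qed.

Lemma frac_eq n d n' d' : d != 0 -> d' != 0 ->
  n%:F / d%:F = n'%:F / d'%:F -> n * d' = n' * d.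
Proof.
move=> d0 d'0 /eqP; rewrite eqr_div ?tofrac_eq0 // -!tofracM tofrac_eq.
by move/eqP.
Qed.

Definition scal (c : K) : Rat := (c%:MP)%:F.
Definition var (i : 'I_2) : Rat := ('X_i)%:F.

(* The derivation of K(x_0, x_1) extending the partial derivative with respect
   to the variable of index [i], by the quotient rule. *)
Definition fderiv (i : 'I_2) f : Rat :=
  ((num f)^`M(i) * den f - num f * (den f)^`M(i))%:F / (den f ^+ 2)%:F.

Definition coord_t : Rat := var i0.
Definition coord_v : Rat := var i1.
Definition d_t : Rat -> Rat := fderiv i0.
Definition d_v : Rat -> Rat := fderiv i1.

Lemma fderiv_frac i n d : d != 0 ->
  fderiv i (n%:F / d%:F) = (n^`M(i) * d - n * d^`M(i))%:F / (d ^+ 2)%:F.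
Proof.
move=> d0; have := num_den (n%:F / d%:F).
rewrite /fderiv; set N := num _; set D := den _.
have D0 : D != 0 by apply: den_neq0.
move/(frac_eq d0 D0) => e.
have e' := congr1 (mderiv i) e; rewrite !mderivM in e'.
apply/eqP; rewrite eqr_div ?tofrac_eq0 ?expf_neq0 // -!tofracM tofrac_eq.
apply/eqP; have {}e' : N^`M(i) * d = n^`M(i) * D + n * D^`M(i) - N * d^`M(i).
  by rewrite e' addrK.
transitivity (D * d * (N^`M(i) * d) - N * d * (d * D^`M(i))); first by ring.
rewrite e' -e.
transitivity (D * d * (n^`M(i) * D) - D * d^`M(i) * (N * d)); first by ring.
rewrite -e; ring.
Qed.

Lemma fderiv_pol i p : fderiv i p%:F = (p^`M(i))%:F.
Proof.
rewrite -[p%:F]divr1 -tofrac1 fderiv_frac ?oner_neq0 //.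
rewrite -mpolyC1 mderivC mpolyC1 mulr0 subr0 mulr1 expr1n tofrac1.
by rewrite divr1.
Qed.

Lemma fderivD i f g : fderiv i (f + g) = fderiv i f + fderiv i g.
Proof.
rewrite {1}[f]num_den {1}[g]num_den {2 3}/fderiv.
move: (num f) (den f) (num g) (den g) (den_neq0 f) (den_neq0 g).
move=> n d n' d' d0 d'0; rewrite addf_div ?tofrac_eq0 //.
rewrite -!tofracM -!tofracD fderiv_frac ?mulf_neq0 //.
rewrite addf_div ?tofrac_eq0 ?expf_neq0 // -!tofracM -!tofracD.
apply/eqP; rewrite eqr_div ?tofrac_eq0 ?mulf_neq0 ?expf_neq0 ?mulf_neq0 //.
rewrite -!tofracM tofrac_eq; apply/eqP.
rewrite !(mderivD, mderivM); ring.
Qed.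

Lemma fderivM i f g : fderiv i (f * g) = fderiv i f * g + f * fderiv i g.
Proof.
rewrite {1 3}[f]num_den {1 2}[g]num_den {2 3}/fderiv.
rewrite mulf_div -!tofracM.
move: (num f) (den f) (num g) (den g) (den_neq0 f) (den_neq0 g).
move=> n d n' d' d0 d'0; rewrite fderiv_frac ?mulf_neq0 //.
rewrite !mulf_div -!tofracM addf_div ?tofrac_eq0 ?mulf_neq0 ?expf_neq0 //.
rewrite -!tofracM -!tofracD.
apply/eqP; rewrite eqr_div ?tofrac_eq0 ?mulf_neq0 ?expf_neq0 ?mulf_neq0 //.
rewrite -!tofracM tofrac_eq; apply/eqP.
rewrite !(mderivD, mderivM); ring.
Qed.

Definition pair2 f g : 'I_2 -> Rat := fun i => if i == i0 then f else g.

Definition peval (a : 'I_2 -> Rat) p : Rat := mmap scal a p.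

Definition fsubst (a : 'I_2 -> Rat) f : Rat :=
  peval a (num f) / peval a (den f).

Fact scal_zmod : zmod_morphism scal.
Proof. by move=> a b; rewrite /scal mpolyCB tofracB. Qed.
Fact scal_monoid : monoid_morphism scal.
Proof. by split=> [|a b]; rewrite /scal ?mpolyC1 ?tofrac1 // mpolyCM tofracM. Qed.
HB.instance Definition _ := GRing.isZmodMorphism.Build K Rat scal scal_zmod.
HB.instance Definition _ := GRing.isMonoidMorphism.Build K Rat scal scal_monoid.
HB.instance Definition _ a := GRing.RMorphism.copy (peval a) (mmap scal a).

(* K(x, y) and K(t, v) are both encoded as the fractions of {mpoly K[2]}, with x
   and t in position 0, y and v in position 1; [to_xy] is the field embedding
   g |-> g(x + y, (y - x) / (x + y)) of K(t, v) into K(x, y). *)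
Definition to_xy g : Rat :=
  let x := var i0 in let y := var i1 in
  fsubst (pair2 (x + y) ((y - x) / (x + y))) g.

(* The polynomials in t and t v. *)
Definition tv_space g :=
  exists q : Pol, g = peval (pair2 coord_t (coord_t * coord_v)) q.

Lemma pevalC a c : peval a c%:MP = scal c.
Proof. exact: mmapC. Qed.

Lemma pevalD a p q : peval a (p + q) = peval a p + peval a q.
Proof. exact: rmorphD. Qed.

Lemma pevalB a p q : peval a (p - q) = peval a p - peval a q.
Proof. exact: rmorphB. Qed.

Lemma pevalM a p q : peval a (p * q) = peval a p * peval a q.
Proof. exact: rmorphM. Qed.

Lemma pevalXn a p k : peval a (p ^+ k) = peval a p ^+ k.
Proof. exact: rmorphXn. Qed.

Lemma pevalZ a c p : peval a (c *: p) = scal c * peval a p.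
Proof. exact: mmapZ. Qed.

Lemma pevalX a i : peval a 'X_i = a i.
Proof. by rewrite /peval mmapX mmap1U. Qed.

Lemma pol_ind (P : Pol -> Prop) :
  (forall c, P c%:MP) -> (forall i, P 'X_i) ->
  (forall p q, P p -> P q -> P (p + q)) ->
  (forall p q, P p -> P q -> P (p * q)) -> forall p, P p.
Proof.
move=> PC PX PD PM; elim/mpolyind => [|c m p _ _ Pp]; first by rewrite -mpolyC0.
apply: (PD) => //; rewrite -mul_mpolyC; apply: (PM) => //; rewrite mpolyXE_id.
apply: (big_ind P) => // [|i _]; first by rewrite -mpolyC1.
by elim: (m i) => [|k IH]; rewrite ?expr0 ?exprS -?mpolyC1 //; apply: PM.
Qed.

Section Change.
Hypothesis two_neq0 : (2 : K) != 0.

Local Notation x := (var i0).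
Local Notation y := (var i1).
Local Notation t := coord_t.
Local Notation v := coord_v.

(* The inverse change of variables x = t (1 - v) / 2, y = t (1 + v) / 2. *)
Definition pol_to_tv p : Rat :=
  peval (pair2 (t * (1 - v) / 2) (t * (1 + v) / 2)) p.

Local Notation subst := (pair2 (x + y) ((y - x) / (x + y))).

Fact two_neq0_rat : (2 : Rat) != 0.
Proof.
have -> : (2 : Rat) = scal 2 by rewrite rmorph_nat.
by rewrite tofrac_eq0 mpolyC_eq0.
Qed.

Fact xDy_neq0 : x + y != 0.
Proof.
rewrite /var -tofracD tofrac_eq0; apply/eqP => /(congr1 (mcoeff U_(i0)%MM)).
by rewrite mcoeffD !mcoeffXU mcoeff0 addr0 => /eqP; rewrite oner_eq0.
Qed.

Lemma var_neq0 i : var i != 0.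
Proof.
rewrite tofrac_eq0; apply/eqP => /(congr1 (mcoeff U_(i)%MM)).
by rewrite mcoeffXU eqxx mcoeff0 => /eqP; rewrite oner_eq0.
Qed.

Lemma peval_subst_neq0 q : q != 0 -> peval subst q != 0.
Proof.
have [N [Q [e1 e2]]] : exists N Q,
    peval subst q * (x + y) ^+ N = Q%:F /\ pol_to_tv Q = t ^+ N * q%:F.
  have tt := two_neq0_rat; elim/pol_ind: q => [c|i|p q|p q].
  - by exists 0%N, c%:MP; rewrite /pol_to_tv !pevalC mulr1 mul1r.
  - have [->|->] : i = i0 \/ i = i1.
      by case: i => -[|[|//]] h; [left|right]; apply: val_inj.
    + exists 0%N, ('X_i0 + 'X_i1); rewrite /pol_to_tv pevalD !pevalX.
      by rewrite !expr0 mulr1 mul1r tofracD; split=> //; rewrite /pair2 /=; field.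
    + exists 1%N, ('X_i1 - 'X_i0); rewrite /pol_to_tv pevalB !pevalX.
      rewrite !expr1 tofracB /pair2 /= divfK ?xDy_neq0 //; split=> //.
      by rewrite -/(var i1); field.
  - move=> [N [Q [e1 e2]]] [N' [Q' [e1' e2']]].
    exists (N + N')%N, (Q * ('X_i0 + 'X_i1) ^+ N' + Q' * ('X_i0 + 'X_i1) ^+ N).
    have e : pol_to_tv ('X_i0 + 'X_i1) = t.
      by rewrite /pol_to_tv pevalD !pevalX /pair2 /=; field.
    split.
      rewrite tofracD !tofracM !tofracXn !tofracD -!/(var _) -e1 -e1'.
      by rewrite pevalD exprD; ring.
    rewrite /pol_to_tv pevalD !pevalM !pevalXn -!/(pol_to_tv _) e e2 e2'.
    by rewrite tofracD exprD; ring.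
  - move=> [N [Q [e1 e2]]] [N' [Q' [e1' e2']]].
    exists (N + N')%N, (Q * Q').
    split; first by rewrite tofracM -e1 -e1' pevalM exprD; ring.
    by rewrite /pol_to_tv pevalM -!/(pol_to_tv _) e2 e2' exprD tofracM; ring.
move=> q0; apply: contra_neq q0 => q0; move: e1 e2; rewrite q0 mul0r.
move/esym/eqP; rewrite tofrac_eq0 => /eqP ->.
rewrite /pol_to_tv [peval _ 0]rmorph0 => /esym/eqP; rewrite mulf_eq0 expf_eq0.
by rewrite (negPf (var_neq0 _)) andbF /= tofrac_eq0 => /eqP.
Qed.

Lemma to_xy_frac n d : d != 0 ->
  to_xy (n%:F / d%:F) = peval subst n / peval subst d.
Proof.
move=> d0; rewrite /to_xy /fsubst.
have := num_den (n%:F / d%:F); set N := num _; set D := den _.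
have D0 : D != 0 by apply: den_neq0.
move/(frac_eq d0 D0)/(congr1 (peval subst)); rewrite !pevalM => e.
by apply/eqP; rewrite eqr_div ?peval_subst_neq0 // e.
Qed.

Lemma to_xy_pol p : to_xy p%:F = peval subst p.
Proof.
rewrite -[p%:F]divr1 -tofrac1 to_xy_frac ?oner_neq0 //.
by rewrite [peval _ 1]rmorph1 divr1.
Qed.

Lemma to_xyD f g : to_xy (f + g) = to_xy f + to_xy g.
Proof.
rewrite [f]num_den [g]num_den.
move: (num f) (den f) (num g) (den g) (den_neq0 f) (den_neq0 g).
move=> n d n' d' d0 d'0; rewrite addf_div ?tofrac_eq0 //.
rewrite -!tofracM -!tofracD !to_xy_frac ?mulf_neq0 //.
by rewrite addf_div ?peval_subst_neq0 // pevalD !pevalM.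
Qed.

Lemma to_xyN f : to_xy (- f) = - to_xy f.
Proof.
apply/eqP; rewrite -subr_eq0 opprK -to_xyD addNr -tofrac0 to_xy_pol.
by rewrite [peval _ 0]rmorph0 tofrac0.
Qed.

Lemma to_xyM f g : to_xy (f * g) = to_xy f * to_xy g.
Proof.
rewrite [f]num_den [g]num_den.
move: (num f) (den f) (num g) (den g) (den_neq0 f) (den_neq0 g).
move=> n d n' d' d0 d'0; rewrite mulf_div -!tofracM.
by rewrite !to_xy_frac ?mulf_neq0 // mulf_div !pevalM.
Qed.

Lemma to_xyV f : to_xy f^-1 = (to_xy f)^-1.
Proof.
have [->|f0] := eqVneq f 0.
  by rewrite invr0 -tofrac0 to_xy_pol [peval _ 0]rmorph0 invr0.
have n0 : num f != 0.
  apply: contra_neq f0 => n0; by rewrite [f]num_den n0 tofrac0 mul0r.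
rewrite [f]num_den invf_div !to_xy_frac ?den_neq0 //.
by rewrite invf_div.
Qed.

Lemma to_xy_eq0 f : (to_xy f == 0) = (f == 0).
Proof.
have -> : to_xy f = peval subst (num f) / peval subst (den f) by [].
rewrite mulf_eq0 invr_eq0 (negPf (peval_subst_neq0 (den_neq0 f))) orbF.
rewrite [f in RHS]num_den mulf_eq0 invr_eq0 !tofrac_eq0.
rewrite (negPf (den_neq0 f)) orbF; have [->|n0] := eqVneq (num f) 0.
  by rewrite [peval _ 0]rmorph0 eqxx.
by rewrite (negPf (peval_subst_neq0 n0)).
Qed.

Lemma to_xy_t : to_xy t = x + y.
Proof. by rewrite to_xy_pol pevalX. Qed.

Lemma to_xy_v : to_xy v = (y - x) / (x + y).
Proof. by rewrite to_xy_pol pevalX. Qed.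

Lemma to_xy_scal c : to_xy (scal c) = scal c.
Proof. by rewrite to_xy_pol pevalC. Qed.

Lemma to_xy_peval a p : to_xy (peval a p) = peval (to_xy \o a) p.
Proof.
elim/pol_ind: p => [c|i|p q IHp IHq|p q IHp IHq].
- by rewrite !pevalC to_xy_scal.
- by rewrite !pevalX.
- by rewrite !pevalD to_xyD IHp IHq.
- by rewrite !pevalM to_xyM IHp IHq.
Qed.

Lemma to_xy_tv_space g : tv_space g -> exists p, to_xy g = p%:F.
Proof.
have ex a b : exists p, a%:F + b%:F = p%:F by exists (a + b); rewrite tofracD.
move=> [q ->]; rewrite to_xy_peval.
elim/pol_ind: q => [c|i|p q [r IHr] [s IHs]|p q [r IHr] [s IHs]].
- by exists c%:MP; rewrite pevalC.
- rewrite pevalX /= /pair2; case: ifP => _.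
    by exists ('X_i0 + 'X_i1); rewrite to_xy_t tofracD.
  exists ('X_i1 - 'X_i0); rewrite to_xyM to_xy_t to_xy_v mulrC.
  by rewrite divfK ?xDy_neq0 // tofracB.
- by exists (r + s); rewrite pevalD IHr IHs tofracD.
- by exists (r * s); rewrite pevalM IHr IHs tofracM.
Qed.

Lemma to_xy_pol_to_tv p : to_xy (pol_to_tv p) = p%:F.
Proof.
have tt := two_neq0_rat; have xy := xDy_neq0.
have two : to_xy 2 = 2.
  by rewrite -[2 in LHS](rmorph_nat scal) to_xy_scal rmorph_nat.
have one : to_xy 1 = 1 by rewrite -(rmorph1 scal) to_xy_scal.
rewrite to_xy_peval; elim/pol_ind: p => [c|i|p q IHp IHq|p q IHp IHq].
- by rewrite pevalC.
- rewrite pevalX /= /pair2; case: (eqVneq i i0) => [->|i_neq0].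
    rewrite !to_xyM to_xyV two to_xyD to_xyN one to_xy_t to_xy_v.
    rewrite -[tofrac _]/(var i0).
    by rewrite (inv_change_x tt xy).
  have -> : i = i1.
    by apply: val_inj; case: i i_neq0 => -[|[|//]] h // /eqP[]; apply: val_inj.
  rewrite !to_xyM to_xyV two to_xyD one to_xy_t to_xy_v.
  rewrite -[tofrac _]/(var i1).
  by rewrite (inv_change_y tt xy).
- by rewrite pevalD IHp IHq tofracD.
- by rewrite pevalM IHp IHq tofracM.
Qed.

Lemma tv_space_pol_to_tv p : tv_space (pol_to_tv p).
Proof.
have tt := two_neq0_rat.
rewrite /pol_to_tv; elim/pol_ind: p => [c|i|p q [r e] [s e']|p q [r e] [s e']].
- by exists c%:MP; rewrite !pevalC.
- rewrite pevalX /pair2; case: ifP => _.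
    exists (2^-1 *: ('X_i0 - 'X_i1)).
    by rewrite pevalZ pevalB !pevalX /= fmorphV rmorph_nat /pair2 /=; field.
  exists (2^-1 *: ('X_i0 + 'X_i1)).
  by rewrite pevalZ pevalD !pevalX /= fmorphV rmorph_nat /pair2 /=; field.
- by exists (r + s); rewrite !pevalD e e'.
- by exists (r * s); rewrite !pevalM e e'.
Qed.

End Change.

Definition jacobi (l l' : K) g : Rat :=
  (coord_v ^+ 2 - 1) * d_v (d_v g)
  + (scal (l - l') + scal (l + l') * coord_v) * d_v g.

(* The operator [A] on K[x, y] reads [D] in the coordinates (t, v): if p(x, y)
   is g(t, v) written in x and y, then A p is D g written in x and y. The lemmas
   [to_xy_tv_space], [to_xy_pol_to_tv], [tv_space_pol_to_tv] and [to_xy_eq0] say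
   that [to_xy] identifies [tv_space] with K[x, y]. *)
Definition in_tv_coords (A : endo Pol) (D : Rat -> Rat) :=
  forall g, tv_space g ->
    exists2 p, to_xy g = p%:F & tv_space (D g) /\ to_xy (D g) = (A p)%:F.

End Coordinates.

Arguments coord_t {K}.
Arguments coord_v {K}.

(* Main.v *)
From HB Require Import structures.
Require Import Defs.
From mathcomp Require Import all_boot all_order all_algebra.
From mathcomp Require Import reals complex mpoly.
From mathcomp Require Import ring.
Import GRing.Theory Num.Theory.
Local Open Scope ring_scope.
Local Open Scope complex_scope.

(* If S denotes the substitution t = x + y, v = (y - x) / (x + y), the chain rule
   reads dx S = S dt - 2y/(x+y)^2 S dv and dy S = S dt + 2x/(x+y)^2 S dv, which
   turns the actions of H, E and F into the stated operators; in x dx^2 + y dy^2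
   the mixed derivatives cancel. The Casimir operator follows by composition,
   since multiplication by t commutes with the Jacobi operator. As S is injective
   and C[x, y] is the image of the polynomials in t and t v, the operators in
   (t, v) preserve the latter space. *)

(** * Derivations of a field *)

Section Derivations.
Set Implicit Arguments.
Unset Strict Implicit.

Record derivation (F : fieldType) (D : F -> F) : Prop := Derivation {
  derD : {morph D : f g / f + g};
  derM : forall f g, D (f * g) = D f * g + f * D g }.

Section Theory.
Variables (F : fieldType) (D : F -> F).
Hypothesis DP : derivation D.
Implicit Types f g : F.

Lemma der0 : D 0 = 0.
Proof. by apply: (addrI (D 0)); rewrite -(derD DP) !addr0. Qed.

Lemma derN f : D (- f) = - D f.
Proof. by apply/eqP; rewrite -addr_eq0 -(derD DP) addNr der0. Qed.

Lemma der1 : D 1 = 0.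
Proof.
by apply: (addrI (D 1)); rewrite addr0 -{3}[1]mulr1 (derM DP) mulr1 mul1r.
Qed.

Lemma der_nat n : D n%:R = 0.
Proof.
by elim: n => [|n IH]; rewrite ?der0 // -natr1 (derD DP) IH der1 addr0.
Qed.

Lemma derV f : f != 0 -> D f^-1 = - D f / f ^+ 2.
Proof.
move=> f0; have := derM DP f f^-1; rewrite mulfV // der1 => /esym/eqP.
rewrite addrC addr_eq0 => /eqP e; apply: (mulfI f0); rewrite e; field.
exact: f0.
Qed.
End Theory.

(** The left side is what the Leibniz rule and [derV] give for the x-derivative of (y - x) / (x +
    y), once the derivatives 0 of y and 1 of x are filled in. *)
Lemma quotient_rule_x (F : fieldType) (x y : F) : x + y != 0 ->
  (0 - 1) * (x + y)^-1 + (y - x) * (- (1 + 0) / (x + y) ^+ 2) =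
  - 2 * y / (x + y) ^+ 2.
Proof. by move=> xy; field. Qed.

Lemma quotient_rule_y (F : fieldType) (x y : F) : x + y != 0 ->
  (1 - 0) * (x + y)^-1 + (y - x) * (- (0 + 1) / (x + y) ^+ 2) =
  2 * x / (x + y) ^+ 2.
Proof. by move=> xy; field. Qed.

(** * The chain rule along a field morphism *)

Section Gap.
Variables (F G : fieldType) (S : {rmorphism F -> G}).
Variables (D : G -> G) (D1 D2 : F -> F) (a b : G).
Hypotheses (DP : derivation D) (D1P : derivation D1) (D2P : derivation D2).

(* The error in the chain rule for [D] and [D1], [D2]; by [chain_gapD] and
   [chain_gapM] it vanishes on a field as soon as it vanishes on generators. *)
Definition chain_gap f := D (S f) - (a * S (D1 f) + b * S (D2 f)).

Lemma chain_gapD f g : chain_gap (f + g) = chain_gap f + chain_gap g.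
Proof.
rewrite /chain_gap rmorphD (derD DP) (derD D1P) (derD D2P) !rmorphD /=; ring.
Qed.

Lemma chain_gapM f g :
  chain_gap (f * g) = chain_gap f * S g + S f * chain_gap g.
Proof.
rewrite /chain_gap rmorphM (derM DP) (derM D1P) (derM D2P).
rewrite !(rmorphD, rmorphM) /=; ring.
Qed.
End Gap.

(** * The operators in t and v, and the Casimir identity *)

Section Operators.
Variables (F : fieldType) (t v l l' : F) (dt dv : F -> F).

Definition opH f := (l + l') * f + 2 * t * dt f.
Definition opJ f := (v ^+ 2 - 1) * dv (dv f) + (l - l' + (l + l') * v) * dv f.
Definition opF f := - t * dt (dt f) - (l + l') * dt f + t^-1 * opJ f.

Hypotheses (dtP : derivation dt) (dvP : derivation dv).
Hypotheses (dt_t : dt t = 1) (dv_t : dv t = 0).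
Hypotheses (dt_l : dt l = 0) (dt_l' : dt l' = 0).

(** Put L = l + l' and T = t dt. The part in [opH] is T^2 + (L + 1) T + L (L + 2) / 4. As dv t = 0,
    [opF] after multiplication by t is - T^2 - (L + 1) T - L + [opJ]. All t-derivatives cancel in
    the sum. *)
Lemma casimir_op f : t != 0 -> (2 : F) != 0 ->
  4^-1 * (opH (opH f) + 2 * opH f) + opF (t * f) =
  (l + l') * (l + l' - 2) / 4 * f + opJ f.
Proof.
move=> t0 two; rewrite /opH /opF /opJ.
rewrite !(derD dtP, derM dtP, derD dvP, derM dvP, der_nat dtP,
  der_nat dvP, dt_t, dv_t, dt_l, dt_l').
rewrite !(derM dtP, derD dvP, derM dvP, der0 dvP, dt_t, dv_t) (der1 dtP).
have four : (4 : F) != 0 by rewrite (natrM _ 2 2) mulf_neq0.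
by field; rewrite four.
Qed.
End Operators.

(** * Passage of the operators to x and y *)

Section Change.
Variables (F G : fieldType) (S : {rmorphism F -> G}).
Variables (t v l l' : F) (x y m m' : G) (dt dv : F -> F) (dx dy : G -> G).
Hypotheses (dxP : derivation dx) (dyP : derivation dy).
Hypotheses (dx_x : dx x = 1) (dx_y : dx y = 0).
Hypotheses (dy_x : dy x = 0) (dy_y : dy y = 1).
Hypotheses (xy0 : x + y != 0) (S_l : S l = m) (S_l' : S l' = m').
Hypotheses (S_t : S t = x + y) (S_v : S v = (y - x) / (x + y)).
Hypothesis dxS :
  forall f, dx (S f) = S (dt f) + - 2 * y / (x + y) ^+ 2 * S (dv f).
Hypothesis dyS :
  forall f, dy (S f) = S (dt f) + 2 * x / (x + y) ^+ 2 * S (dv f).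

(** In x dx + y dy the coefficients of [dv] cancel, and those of [dt] add up to x + y = S t. *)
Lemma change_H f : S (opH t l l' dt f) =
  m * S f + 2 * (x * dx (S f)) + (m' * S f + 2 * (y * dy (S f))).
Proof.
rewrite /opH !(rmorphD, rmorphM, rmorph_nat) /= S_t S_l S_l' dxS dyS.
by field.
Qed.

(** Let a, b be the coefficients of S dv in the chain rules for dx, dy. Then x a + y b = 0 removes
    both orders of the mixed derivative, x a^2 + y b^2 = 4 x y / (x + y)^3 is the image of (1 - v^2)
    / t, and x dx(a) + y dy(b) = 0, so that only - m a - m' b remains in first order in v. *)
Lemma change_F f : S (opF t v l l' dt dv f) =
  - (x * dx (dx (S f))) - m * dx (S f)
  + (- (y * dy (dy (S f))) - m' * dy (S f)).
Proof.
have xy2 : (x + y) ^+ 2 != 0 by rewrite expf_neq0.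
rewrite dxS dyS (derD dxP) (derD dyP) !dxS !dyS.
(* The Leibniz rule first splits the coefficients from S (dv f), then isolates the inverse, so that
   [derV] meets the inverse of (x + y)^2 whole. *)
rewrite !(derM dxP _ (S _)) !(derM dyP _ (S _)) !dxS !dyS.
rewrite !(derM dxP _ _^-1) !(derM dyP _ _^-1).
rewrite !(derV dxP xy2) !(derV dyP xy2) expr2.
rewrite !(derD dxP, derM dxP, derD dyP, derM dyP, derN dxP,
  derN dyP, der_nat dxP, der_nat dyP).
rewrite (der1 dxP) dx_x dx_y dy_x dy_y /opF /opJ.
rewrite !(rmorphD, rmorphB, rmorphN, rmorphM, rmorphXn, rmorph1, fmorphV) /=.
rewrite S_t S_v S_l S_l'.
by field.
Qed.
End Change.
End Derivations.

(** * The chain rule for rational functions *)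

Section ChangeOfCoordinates.
Set Implicit Arguments.
Unset Strict Implicit.
Variable K : fieldType.
Hypothesis two_neq0 : (2 : K) != 0.
Local Notation Pol := {mpoly K[2]}.
Local Notation Rat := {fraction {mpoly K[2]}}.
Local Notation "p %:F" := (@FracField.tofrac {mpoly K[2]} p).
Local Notation i0 := (ord0 : 'I_2).
Local Notation i1 := (ord_max : 'I_2).
Local Notation x := (var K i0).
Local Notation y := (var K i1).
Local Notation t := (@coord_t K).
Local Notation v := (@coord_v K).
Implicit Types (p q : Pol) (f g : Rat) (c : K).

Lemma ord2_cases (i : 'I_2) : i = i0 \/ i = i1.
Proof. by case: i => -[|[|//]] h; [left|right]; apply: val_inj. Qed.

Lemma fderiv_derivation i : derivation (@fderiv K i).
Proof. by split=> f g; [apply: fderivD|apply: fderivM]. Qed.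

Lemma fderiv_scal i c : fderiv i (scal c) = 0.
Proof. by rewrite fderiv_pol mderivC tofrac0. Qed.

Lemma fderiv_var i j : fderiv i (var K j) = (i == j)%:R.
Proof.
rewrite /var fderiv_pol mderivX mnm1E eq_sym; have [->|_] := eqVneq i j.
  have -> : (U_(j) - U_(j) = 0 :> 'X_{1..2})%MM.
    by apply/mnmP => k; rewrite mnmBE subnn mnm0E.
  by rewrite mpolyX0 scale1r tofrac1.
by rewrite scale0r tofrac0.
Qed.

Fact to_xy_zmod : zmod_morphism (@to_xy K).
Proof. by move=> f g; rewrite to_xyD // to_xyN. Qed.
Fact to_xy_monoid : monoid_morphism (@to_xy K).
Proof.
by split=> [|f g]; rewrite ?to_xyM // -(rmorph1 (@scal K)) to_xy_scal.
Qed.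
(** The morphism is packed as a term because its laws depend on [two_neq0]. *)
Definition to_xy_rmorph : {rmorphism Rat -> Rat} :=
  HB.pack (@to_xy K) (GRing.isZmodMorphism.Build _ _ (@to_xy K) to_xy_zmod)
    (GRing.isMonoidMorphism.Build _ _ (@to_xy K) to_xy_monoid).

Lemma to_xy_inj : injective (@to_xy K).
Proof. exact: (fmorph_inj to_xy_rmorph). Qed.

(* The factor [b] is the derivative of v = (y - x) / (x + y) with respect to the
   [i]-th variable; that of t = x + y is 1. *)
Lemma chain_rule i g :
  let b := (if i == i0 then - 2 * y else 2 * x) / (x + y) ^+ 2 in
  fderiv i (to_xy g) = to_xy (d_t g) + b * to_xy (d_v g).
Proof.
move=> b; have xy := xDy_neq0 K.
have dP := fderiv_derivation.
pose gap := chain_gap to_xy_rmorph (@fderiv K i) (@d_t K) (@d_v K) 1 b.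
have gapE f :
  gap f = fderiv i (to_xy f) - (1 * to_xy (d_t f) + b * to_xy (d_v f)).
  by [].
have gapD f h : gap (f + h) = gap f + gap h by apply: chain_gapD; apply: dP.
have gapM f h : gap (f * h) = gap f * to_xy h + to_xy f * gap h.
  exact: (chain_gapM to_xy_rmorph _ _ (dP i) (dP i0) (dP i1)).
have to_xy0 : to_xy 0 = 0 := rmorph0 to_xy_rmorph.
have to_xy1 : to_xy 1 = 1 := rmorph1 to_xy_rmorph.
have gap_pol p : gap p%:F = 0.
  elim/pol_ind: p => [c|j|p q IHp IHq|p q IHp IHq].
  - rewrite gapE to_xy_scal // !fderiv_scal /d_t /d_v !fderiv_scal.
    by rewrite to_xy0 !mulr0 addr0 subr0.
  - rewrite gapE /d_t /d_v -/(var K j) !fderiv_var mul1r.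
    have [->|->] := ord2_cases j.
      rewrite to_xy_t // fderivD !fderiv_var /= to_xy0 to_xy1 mulr0 addr0.
      by have [->|->] := ord2_cases i; rewrite /= ?addr0 ?add0r subrr.
    rewrite to_xy_v // /= to_xy0 to_xy1 add0r mulr1 /b.
    rewrite fderivM (derV (dP i)) // !fderivD (derN (dP i)) !fderiv_var.
    have [->|->] := ord2_cases i; rewrite /=.
      by rewrite quotient_rule_x ?subrr.
    by rewrite quotient_rule_y ?subrr.
  - by rewrite tofracD gapD IHp IHq addr0.
  - by rewrite tofracM gapM IHp IHq mul0r mulr0 addr0.
(* From polynomials to fractions: the gap vanishes at g times its denominator and at the
   denominator, and the image of the denominator is nonzero. *)
suff: gap g == 0 by rewrite gapE mul1r subr_eq0 => /eqP.
have d0 : (den g)%:F != 0 by rewrite tofrac_eq0 den_neq0.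
have := gapM g (den g)%:F.
rewrite {1}[g]num_den divfK // !gap_pol mulr0 addr0 => /esym/eqP.
by rewrite mulf_eq0 to_xy_eq0 // (negPf d0) orbF.
Qed.

(* Unlike [in_tv_coords], this quantifies over all rational functions, which
   makes it stable under composition. *)
Definition transported (A : endo Pol) (D : Rat -> Rat) :=
  forall g p, to_xy g = p%:F -> to_xy (D g) = (A p)%:F.

(** The polynomial A p also has the preimage [pol_to_tv (A p)], which lies in [tv_space];
    injectivity of [to_xy] identifies it with D g. *)
Lemma transported_in_tv_coords A D : transported A D -> in_tv_coords A D.
Proof.
move=> AD g /(to_xy_tv_space two_neq0)[p gp]; exists p => //.
have e := AD g p gp; split=> //.
have -> : D g = pol_to_tv (A p) by apply: to_xy_inj; rewrite e to_xy_pol_to_tv.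
exact: tv_space_pol_to_tv.
Qed.

Lemma eq_transported A D D' : D =1 D' -> transported A D -> transported A D'.
Proof. by move=> DD' AD g p /AD; rewrite DD'. Qed.

Lemma transportedD A D A' D' : transported A D -> transported A' D' ->
  transported (A + A') (fun g => D g + D' g).
Proof.
by move=> AD AD' g p gp; rewrite to_xyD // (AD _ _ gp) (AD' _ _ gp) -tofracD.
Qed.

Lemma transportedM A D A' D' : transported A D -> transported A' D' ->
  transported (A * A') (D \o D').
Proof. by move=> AD AD' g p gp; apply/AD/AD'. Qed.

Lemma transportedZ c A D : transported A D ->
  transported (c *: A) (fun g => scal c * D g).
Proof.
move=> AD g p gp.
by rewrite to_xyM // to_xy_scal // (AD _ _ gp) -tofracM mul_mpolyC.
Qed.

(** * The action on the tensor product in the new coordinates *)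

Variables l1 l2 : K.
Local Notation rho := (tensor_rep l1 l2).
Local Notation m1 := (scal l1).
Local Notation m2 := (scal l2).

Lemma primitive_repE (u : usl2 K) p :
  rho (primitive u) p = verma i0 l1 u p + verma i1 l2 u p.
Proof. by rewrite rmorphD endoDE /= !tensor_repE !rmorph1. Qed.

Lemma scal_nat n : scal (n%:R : K) = n%:R.
Proof. exact: rmorph_nat. Qed.

Lemma chain_rule_x g : fderiv i0 (to_xy g) =
  to_xy_rmorph (d_t g) + - 2 * y / (x + y) ^+ 2 * to_xy_rmorph (d_v g).
Proof. exact: (chain_rule i0). Qed.

Lemma chain_rule_y g : fderiv i1 (to_xy g) =
  to_xy_rmorph (d_t g) + 2 * x / (x + y) ^+ 2 * to_xy_rmorph (d_v g).
Proof. exact: (chain_rule i1). Qed.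

Lemma transported_H :
  transported (rho (primitive sl2H)) (opH t m1 m2 (@d_t K)).
Proof.
move=> g p gp; rewrite primitive_repE.
have [-> _ _] := vermaE_gen i0 l1 p; have [-> _ _] := vermaE_gen i1 l2 p.
(* Derivatives of p are read as [fderiv] of its fraction, which is [to_xy g], so that the chain rule
   applies. *)
rewrite /vermaH -!mul_mpolyC !(tofracD, tofracM) -!fderiv_pol -gp.
rewrite -![_%:MP%:F]/(scal _) !scal_nat.
apply: (change_H (S := to_xy_rmorph)).
- exact: xDy_neq0.
- exact: to_xy_scal.
- exact: to_xy_scal.
- exact: to_xy_t.
- exact: chain_rule_x.
- exact: chain_rule_y.
Qed.

Lemma transported_E : transported (rho (primitive sl2E)) ( *%R t).
Proof.
move=> g p gp; rewrite primitive_repE.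
have [_ -> _] := vermaE_gen i0 l1 p; have [_ -> _] := vermaE_gen i1 l2 p.
by rewrite /vermaE tofracD !tofracM -gp to_xyM // to_xy_t // -mulrDl.
Qed.

Lemma transported_F :
  transported (rho (primitive sl2F)) (opF t v m1 m2 (@d_t K) (@d_v K)).
Proof.
move=> g p gp; rewrite primitive_repE.
have [_ _ ->] := vermaE_gen i0 l1 p; have [_ _ ->] := vermaE_gen i1 l2 p.
rewrite /vermaF -!mul_mpolyC !(tofracD, tofracN, tofracM) -!fderiv_pol -gp.
apply: (change_F (S := to_xy_rmorph)).
- exact: fderiv_derivation.
- exact: fderiv_derivation.
- exact: fderiv_var.
- exact: fderiv_var.
- exact: fderiv_var.
- exact: fderiv_var.
- exact: xDy_neq0.
- exact: to_xy_scal.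
- exact: to_xy_scal.
- exact: to_xy_t.
- exact: to_xy_v.
- exact: chain_rule_x.
- exact: chain_rule_y.
Qed.

Lemma jacobi_opJ : jacobi l1 l2 =1 opJ v m1 m2 (@d_v K).
Proof. by move=> g; rewrite /jacobi rmorphB rmorphD. Qed.

(** Stated for any morphism, so as to serve for both [delta] and the representation. *)
Lemma casimir_morph (A B : algType K) (phi : {lrmorphism A -> B}) (h e f : A) :
  phi (4^-1 *: (h ^+ 2 + 2 *: h) + f * e) =
  4^-1 *: (phi h ^+ 2 + 2 *: phi h) + phi f * phi e.
Proof. by rewrite linearD linearZ linearD linearZ rmorphXn rmorphM. Qed.

Lemma transported_casimir : transported (rho (delta casimir))
  (fun g => scal ((l1 + l2) * (l1 + l2 - 2) / 4) * g + jacobi l1 l2 g).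
Proof.
have [dH dE dF] := delta_primitive K.
have -> : rho (delta casimir) =
    4^-1 *: (rho (primitive sl2H) * rho (primitive sl2H)
             + 2 *: rho (primitive sl2H))
    + rho (primitive sl2F) * rho (primitive sl2E).
  by rewrite /primitive -dH -dE -dF -expr2 /casimir !casimir_morph.
have TH := transported_H.
(* The composite of the transported operators corresponds to the Casimir element; [casimir_op] then
   simplifies it. *)
apply: eq_transported (transportedD (transportedZ 4^-1
  (transportedD (transportedM TH TH) (transportedZ 2 TH)))
  (transportedM transported_F transported_E)) => g /=.
have -> : scal ((l1 + l2) * (l1 + l2 - 2) / 4) =
    (m1 + m2) * (m1 + m2 - 2) / 4.
  by rewrite rmorphM fmorphV rmorphM rmorphB rmorphD !rmorph_nat.
rewrite jacobi_opJ fmorphV !rmorph_nat.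
apply: casimir_op.
- exact: fderiv_derivation.
- exact: fderiv_derivation.
- exact: fderiv_var.
- exact: fderiv_var.
- exact: fderiv_scal.
- exact: fderiv_scal.
- exact: var_neq0.
- exact: two_neq0_rat.
Qed.

End ChangeOfCoordinates.

Theorem proposition3p5 (R : realType) (N : nat) (l1 l2 : R[i])
  (N_gt0 : (0 < N)%N)
  (hl1 : forall k : nat, (k <= N - 1)%N -> l1 != - k%:R)
  (hl2 : forall k : nat, (k <= N - 1)%N -> l2 != - k%:R)
  (hl12 : forall k : nat, (k <= 2 * N - 2)%N -> l1 + l2 != - k%:R) :
  let rho := tensor_rep l1 l2 in
  let t : {fraction {mpoly R[i][2]}} := coord_t in
  let Phi := @jacobi R[i] l1 l2 in
  [/\ in_tv_coords (rho (sl2H ⊗ 1 + 1 ⊗ sl2H))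
         (fun g => scal (l1 + l2) * g + 2 * t * d_t g),
      in_tv_coords (rho (sl2E ⊗ 1 + 1 ⊗ sl2E))
         (fun g => t * g),
      in_tv_coords (rho (sl2F ⊗ 1 + 1 ⊗ sl2F))
         (fun g => - t * d_t (d_t g) - scal (l1 + l2) * d_t g + t^-1 * Phi g)
    & in_tv_coords (rho (delta casimir))
         (fun g => scal ((l1 + l2) * (l1 + l2 - 2) / 4) * g + Phi g)].
Proof.
move=> rho t Phi; have two : (2 : R[i]) != 0 by rewrite pnatr_eq0.
split; apply: transported_in_tv_coords => //.
- apply: eq_transported (transported_H two l1 l2) => g.
  by rewrite rmorphD.
- exact: transported_E.
- apply: eq_transported (transported_F two l1 l2) => g.
  by rewrite /opF -jacobi_opJ rmorphD.
- exact: transported_casimir.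
Qed.
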